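(* Let $F_T:\widehat T\to T\subset\mathbb R^3$ be a regular parameterization of a curved triangle $T$ on a smooth oriented surface, $J=DF_T$, $G=J^TJ$. Let an edge $\hat e\subset\partial\widehat T$ be parameterized by $\hat\gamma(t)$ and $e=F_T(\hat e)$ by $\gamma=F_T\circ\hat\gamma$. If a tangent vector field $v$ on $T$ and a vector field $\hat v:\widehat T\to\mathbb R^2$ are related by the covariant Piola map $v\circ F_T=JG^{-1}\hat v$, then $$(v\circ\gamma)\cdot\gamma'(t)=(\hat v\circ\hat\gamma)\cdot\hat\gamma'(t).$$ Hence, when the two element maps sharing $e$ agree on $\hat e$, equality of the Bernstein coefficients of the tangential components on the two reference triangles is equivalent to equality of the tangential trace on the curved edge; that is, the reference tangential functionals are inherited on the surface without change.
   Context: $\widehat T\subset\mathbb R^2$ is the reference triangle. A regular map is a smooth injective map with $J=DF_T\in\mathbb R^{3\times2}$ of full rank; for tangent $v$, $v\circ F_T=JG^{-1}\hat v$ is equivalent to $J^T(v\circ F_T)=\hat v$. Two element maps $F_{\pm}$ sharing a curved edge $e$ agree on the reference edge if there are affine parameterizations $\hat\gamma_\pm:[0,1]\to\hat e_\pm$ of the corresponding reference edges with $F_+\circ\hat\gamma_+=F_-\circ\hat\gamma_-=\gamma$. For polynomial reference fields $\hat v_\pm\in[\mathcal P_d(\widehat T)]^2$, the Bernstein coefficients of the tangential component are the coefficients of the univariate polynomial $t\mapsto\hat v_\pm(\hat\gamma_\pm(t))\cdot\hat\gamma_\pm'(t)$ in the basis $\binom djt^j(1-t)^{d-j}$, $j=0,\dots,d$,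 and equality of the tangential trace on $e$ means $(v_+\circ\gamma)\cdot\gamma'=(v_-\circ\gamma)\cdot\gamma'$, where $v_\pm$ are the mapped fields on the two curved triangles. *)

(* Defs.v *)
From HB Require Import structures.
From mathcomp Require Import all_boot all_order all_algebra.
From mathcomp Require Import all_classical all_reals all_analysis.
(* Required but not imported: its notations clash with those of analysis. *)
From mathcomp Require mpoly.

Set Implicit Arguments.
Unset Strict Implicit.
Unset Printing Implicit Defensive.

Import Order.TTheory GRing.Theory Num.Theory numFieldNormedType.Exports.

Local Open Scope classical_set_scope.
Local Open Scope ring_scope.

(* Points and vectors of R^n are row vectors, as in the analysis library. *)

Definition dot (R : realType) (n : nat) (u v : 'rV[R]_n) : R :=
  (u *m v^T) 0 0.

(* [jacobian] acts on row vectors from the right; its transpose is the usual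
   m x n matrix of partial derivatives. *)
Definition Dmx (R : realType) (n m : nat) (F : 'rV[R]_n -> 'rV[R]_m)
  (x : 'rV[R]_n) : 'M[R]_(m, n) := (jacobian F x)^T.

(* For an open [U] in a finite-dimensional [V] this is the usual class C^k:
   there, continuity of all directional derivatives is continuity of the
   differential. *)
Fixpoint Ck_on (R : realType) (V W : normedModType R) (k : nat) (U : set V)
  (f : V -> W) : Prop :=
  if k is k'.+1 then
    (forall x, U x -> differentiable f x) /\
    (forall v, Ck_on k' U (fun x => 'D_v f x))
  else forall x, U x -> {for x, continuous f}.

Definition smooth_on (R : realType) (V W : normedModType R) (U : set V)
  (f : V -> W) : Prop := forall k, Ck_on k U f.

(* Smoothness on a set that need not be open: [f] is its own smooth extension
   to an open neighbourhood of [A]. *)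
Definition smooth_near (R : realType) (V W : normedModType R) (A : set V)
  (f : V -> W) : Prop :=
  exists U : set V, [/\ open U, A `<=` U & smooth_on U f].

(* The reference triangle with vertices (0,0), (1,0), (0,1), through its
   barycentric coordinates. *)

Definition bary (R : realType) (x : 'rV[R]_2) (i : 'I_3) : R :=
  [:: 1 - x 0 0 - x 0 1; x 0 0; x 0 1]`_i.

Definition ref_triangle (R : realType) : set 'rV[R]_2 :=
  [set x | forall i, 0 <= bary x i].

Definition ref_edge (R : realType) (i : 'I_3) : set 'rV[R]_2 :=
  [set x | ref_triangle x /\ bary x i = 0].

Definition regular_map (R : realType) (F : 'rV[R]_2 -> 'rV[R]_3) : Prop :=
  [/\ smooth_near (@ref_triangle R) F,
      set_inj (@ref_triangle R) F &
      forall x, ref_triangle x -> \rank (Dmx F x) = 2%N].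

(* Smooth oriented surfaces in R^3: every point has a neighbourhood in [S]
   that is the homeomorphic image of an open set of the plane under a smooth
   immersion ([Y] is the continuous inverse of the chart [X]). *)

Definition smooth_surface (R : realType) (S : set 'rV[R]_3) : Prop :=
  forall p, S p ->
    exists (U : set 'rV[R]_2) (V : set 'rV[R]_3)
           (X : 'rV[R]_2 -> 'rV[R]_3) (Y : 'rV[R]_3 -> 'rV[R]_2),
      [/\ open U, open V & V p] /\
      [/\ smooth_on U X,
          (forall x, U x -> \rank (Dmx X x) = 2%N),
          set_bij U (S `&` V) X,
          (forall x, U x -> Y (X x) = x) &
          {within S `&` V, continuous Y}].

(* Tangent vectors are the velocities of smooth curves in [S]. *)
Definition tangent_to (R : realType) (S : set 'rV[R]_3) (p w : 'rV[R]_3) :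
  Prop :=
  exists c : R -> 'rV[R]_3,
    [/\ smooth_near [set 0] c, c 0 = p, (\forall t \near 0, S (c t)) &
        derive1 c 0 = w].

(* An orientation is a continuous (hence smooth) unit normal field. *)
Definition oriented_surface (R : realType) (S : set 'rV[R]_3)
  (nu : 'rV[R]_3 -> 'rV[R]_3) : Prop :=
  [/\ smooth_surface S,
      {within S, continuous nu},
      (forall p, S p -> dot (nu p) (nu p) = 1) &
      forall p w, S p -> tangent_to S p w -> dot (nu p) w = 0].

Definition curved_triangle_on (R : realType) (S : set 'rV[R]_3)
  (F : 'rV[R]_2 -> 'rV[R]_3) : Prop :=
  regular_map F /\ F @` (@ref_triangle R) `<=` S.

Definition tangent_field (R : realType) (S T : set 'rV[R]_3)
  (v : 'rV[R]_3 -> 'rV[R]_3) : Prop :=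
  forall y, T y -> tangent_to S y (v y).

Definition covariant_piola (R : realType) (F : 'rV[R]_2 -> 'rV[R]_3)
  (vh : 'rV[R]_2 -> 'rV[R]_2) (v : 'rV[R]_3 -> 'rV[R]_3) : Prop :=
  forall x, ref_triangle x ->
    let J := Dmx F x in
    let G := J^T *m J in
    (v (F x))^T = J *m invmx G *m (vh x)^T.

(* Parameterizations are total functions on R of which only the restriction
   to [0, 1] matters; derivatives at 0 and 1 are those of the extension, and
   coincide with the one-sided ones. *)

Definition edge_param (R : realType) (eh : set 'rV[R]_2)
  (gh : R -> 'rV[R]_2) : Prop :=
  (forall t : R, t \in `[0, 1] -> derivable gh t 1) /\
  set_bij `[0, 1] eh gh.

Definition affine_edge_param (R : realType) (eh : set 'rV[R]_2)
  (gh : R -> 'rV[R]_2) : Prop :=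
  (exists a b, forall t, gh t = a + t *: b) /\ set_bij `[0, 1] eh gh.

Definition tangential (R : realType) (n : nat) (v : 'rV[R]_n -> 'rV[R]_n)
  (g : R -> 'rV[R]_n) (t : R) : R := dot (v (g t)) (derive1 g t).

(* [P_d]^2 on the reference triangle: every monomial has total degree at most
   [d]. *)
Definition poly_field (R : realType) (d : nat)
  (vh : 'rV[R]_2 -> 'rV[R]_2) : Prop :=
  forall i : 'I_2, exists p : mpoly.mpoly 2 R,
    all (fun m => (mpoly.mdeg m <= d)%N) (mpoly.msupp p) /\
    forall x, ref_triangle x -> vh x 0 i = mpoly.meval (fun j => x 0 j) p.

Definition bernstein (R : realType) (d j : nat) (t : R) : R :=
  'C(d, j)%:R * t ^+ j * (1 - t) ^+ (d - j).

Definition bernstein_expansion (R : realType) (d : nat) (q : R -> R)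
  (c : 'rV[R]_d.+1) : Prop :=
  forall t : R, t \in `[0, 1] -> q t = \sum_(j < d.+1) c 0 j * bernstein d j t.

(* The Bernstein coefficients of [q] on [0, 1]; they are unique by
   [bernstein_expansion_inj], and 0 by convention when [q] has no expansion. *)
Definition bernstein_coefs (R : realType) (d : nat) (q : R -> R) :
  'rV[R]_d.+1 := xget 0 [set c | bernstein_expansion q c].

Lemma bernstein_expansion_inj (R : realType) (d : nat) (q : R -> R)
  (c c' : 'rV[R]_d.+1) :
  bernstein_expansion q c -> bernstein_expansion q c' -> c = c'.
Proof.
move=> hc hc'.
pose p : {poly R} := \poly_(j < d.+1) ((c 0 (inord j) - c' 0 (inord j)) *
  'C(d, j)%:R).
have p0 : p = 0.
  apply: contrapT => /eqP pn0.
  pose s := [seq (i%:R : R) | i <- iota 0 (size p)].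
  have : (size s < size p)%N.
    apply: max_poly_roots => //; last first.
      by rewrite map_inj_uniq ?iota_uniq// => i j /eqP; rewrite eqr_nat => /eqP.
    apply/allP => x /mapP[k _ ->]; apply/rootP.
    have k1 : (0 : R) < 1 + k%:R by rewrite ltr_pwDl// ler0n.
    set t : R := k%:R / (1 + k%:R).
    have t01 : t \in `[0, 1].
      rewrite in_itv/= divr_ge0 ?ler0n ?(ltW k1)//=.
      by rewrite ler_pdivrMr// mul1r lerDr.
    have tE : 1 - t = (1 + k%:R)^-1.
      by rewrite -[X in X - _](divff (lt0r_neq0 k1)) -mulrBl addrK div1r.
    have /eqP := hc t t01; rewrite (hc' t t01) eq_sym -subr_eq0 -sumrB => /eqP h.
    apply: (mulfI (lt0r_neq0 (exprn_gt0 d (_ : 0 < (1 + k%:R : R)^-1)))).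
      by rewrite invr_gt0.
    rewrite mulr0 -[RHS]h horner_poly mulr_sumr; apply: eq_bigr => j _.
    rewrite inord_val /bernstein tE /t expr_div_n -mulrBl -exprVn.
    have -> : (1 + k%:R : R)^-1 ^+ d =
        (1 + k%:R)^-1 ^+ j * (1 + k%:R)^-1 ^+ (d - j).
      by rewrite -exprD subnKC// -ltnS.
    by rewrite [LHS]mulrC -!mulrA.
  by rewrite /s size_map size_iota ltnn.
apply/rowP => j; apply/eqP; rewrite -subr_eq0.
have /eqP := congr1 (fun r : {poly R} => r`_j) p0.
rewrite coef_poly ltn_ord coef0 inord_val mulf_eq0 pnatr_eq0.
by rewrite -leqn0 leqNgt bin_gt0 -ltnS ltn_ord orbF.
Qed.

Lemma bernstein_coefsE (R : realType) (d : nat) (q : R -> R)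
  (c : 'rV[R]_d.+1) :
  bernstein_expansion q c -> bernstein_coefs d q = c.
Proof.
by move=> hc; apply: xget_subset1 => // a b; exact: bernstein_expansion_inj.
Qed.

(* Main.v *)
(* By the chain rule gamma' = J gammah', so gamma' pairs with J G^-1 vh as
   gammah' pairs with J^T J G^-1 vh = vh; G is invertible since J has full
   rank. Along an affine edge the reference trace is a polynomial of degree at
   most d, hence determined by its Bernstein coefficients, and the trace on the
   curved edge is the same function of t. *)
Require Import Defs.
From mathcomp Require Import all_boot all_order all_algebra.
From mathcomp Require Import all_classical all_reals all_analysis.
From mathcomp Require mpoly.
From mathcomp Require Import ring.

Import Order.TTheory GRing.Theory Num.Theory numFieldNormedType.Exports.

Local Open Scope classical_set_scope.
Local Open Scope ring_scope.

(** * Pointwise invariance of the tangential component under the Piola map *)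

Lemma dot_eq0 {R : realType} (n : nat) (u : 'rV[R]_n) : dot u u = 0 -> u = 0.
Proof.
rewrite /dot mxE => /eqP; rewrite psumr_eq0; last first.
  by move=> j _; rewrite mxE -expr2 sqr_ge0.
move=> /allP u0; apply/rowP => j; rewrite mxE; apply/eqP.
by have := u0 j (mem_index_enum j); rewrite mxE mulf_eq0 orbb.
Qed.

(** If [x] annihilates the Gram matrix, then [x *m A^T] has squared length 0, and [A^T] is row free
    by the rank hypothesis. *)
Lemma gram_unitmx {R : realType} (m n : nat) (A : 'M[R]_(m, n)) :
  \rank A = n -> A^T *m A \in unitmx.
Proof.
move=> rA; rewrite -row_free_unit; apply: inj_row_free => x xG0.
have /eqP : x *m A^T = 0.
  by apply: dot_eq0; rewrite /dot trmx_mul trmxK mulmxA -(mulmxA x) xG0 mul0mx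
    mxE.
by rewrite mulmx_free_eq0 => [/eqP//|]; rewrite /row_free mxrank_tr rA.
Qed.

Lemma regular_map_differentiable {R : realType} (F : 'rV[R]_2 -> 'rV[R]_3)
    (x : 'rV[R]_2) :
  regular_map F -> ref_triangle x -> differentiable F x.
Proof. by move=> [[U [_ TU /(_ 1%N)[dF _]]] _ _] /TU; exact: dF. Qed.

Lemma derive1_comp_Dmx {R : realType} (n m : nat) (F : 'rV[R]_n -> 'rV[R]_m)
    (c : R -> 'rV[R]_n) (t : R) :
  differentiable F (c t) -> derivable c t 1 ->
  derive1 (F \o c) t = derive1 c t *m (Dmx F (c t))^T.
Proof.
move=> dF /derivable1_diffP dc; rewrite !derive1E'//; last first.
  exact: differentiable_comp.
by rewrite diff_comp//= /Dmx trmxK -deriveEjacobian// deriveE.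
Qed.

Lemma tangential_piola {R : realType} (F : 'rV[R]_2 -> 'rV[R]_3)
    (v : 'rV[R]_3 -> 'rV[R]_3) (vh : 'rV[R]_2 -> 'rV[R]_2) (c : R -> 'rV[R]_2)
    (t : R) :
  regular_map F -> covariant_piola F vh v -> ref_triangle (c t) ->
  derivable c t 1 -> tangential v (F \o c) t = tangential vh c t.
Proof.
move=> rF pF Tc dc; have [_ _ rkF] := rF; rewrite /tangential /dot.
rewrite derive1_comp_Dmx//; last exact: regular_map_differentiable.
rewrite -[v _]trmxK /= pF//; move: (rkF _ Tc) => {rkF pF}.
move: (Dmx F _) => J /gram_unitmx G_unit.
(* Since G is symmetric, transposing turns the left side into vh G^-1 J^T J times the transposed
   velocity of [c], where G^-1 cancels J^T J. *)
rewrite !trmx_mul trmx_inv trmx_mul !trmxK -!mulmxA; congr ((_ *m _) _ _).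
by rewrite (mulmxA J^T) mulKmx.
Qed.

(* The two functions may differ outside [a, b], so at the endpoints only a
   one-sided difference quotient is shared. *)
Lemma eq_derive1_itv {R : realType} (V : normedModType R) (f g : R -> V)
    (a b t : R) :
  a < b -> t \in `[a, b] -> {in `[a, b], f =1 g} ->
  derivable f t 1 -> derivable g t 1 -> derive1 f t = derive1 g t.
Proof.
move=> ab; rewrite in_itv/= => /andP[at_ tb] fg df dg; rewrite !derive1E.
have fgt : f t = g t by apply: fg; rewrite in_itv/= at_.
have limE (G : set_system R) : Filter G ->
    (\forall h \near G, h + t \in `[a, b]) ->
    lim ((fun h => h^-1 *: ((f \o shift t) (h *: (1 : R)) - f t)) @ G) =
    lim ((fun h => h^-1 *: ((g \o shift t) (h *: (1 : R)) - g t)) @ G).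
  move=> FG Gab; congr (lim _); apply/seteqP; split; apply: near_eq_cvg;
  by apply: filterS Gab => h hab /=; rewrite fgt [_%:A]mulr1 fg.
(* A two-sided derivative equals either one-sided limit. To the left of [b] there is room for
   positive increments; at [t = b] the hypothesis [a < b] leaves room for negative ones. *)
have [tltb|] := ltP t b.
  rewrite ['D_1 f t]cvg_at_rightE// ['D_1 g t]cvg_at_rightE//; apply: limE.
  near=> h; rewrite in_itv/=; apply/andP; split.
    by rewrite ler_wpDl// ltW//; near: h; exact: nbhs_right_gt.
  by rewrite -lerBrDr; near: h; apply: nbhs_right_le; rewrite subr_gt0.
move=> bt; have atlt : a < t by exact: lt_le_trans ab bt.
rewrite ['D_1 f t]cvg_at_leftE// ['D_1 g t]cvg_at_leftE//; apply: limE.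
near=> h; rewrite in_itv/=; apply/andP; split.
  by rewrite -lerBlDr; near: h; apply: nbhs_left_ge; rewrite subr_lt0.
by rewrite ler_wnDl// ltW//; near: h; exact: nbhs_left_lt.
Unshelve. all: by end_near. Qed.

(** * Closure properties of Bernstein expansions on [0, 1] *)

(** Equivalently, [q] agrees on [0, 1] with a polynomial of degree at most [d]. *)
Definition has_bernstein {R : realType} (d : nat) (q : R -> R) : Prop :=
  exists c : 'rV[R]_d.+1, bernstein_expansion q c.

Lemma eq_bernstein_expansion {R : realType} (d : nat) (q r : R -> R)
    (c : 'rV[R]_d.+1) :
  {in `[0, 1], q =1 r} -> bernstein_expansion q c -> bernstein_expansion r c.
Proof. by move=> qr qc t t01; rewrite -qr// qc. Qed.

Lemma eq_bernstein_coefs {R : realType} (d : nat) (q r : R -> R) :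
  {in `[0, 1], q =1 r} -> bernstein_coefs d q = bernstein_coefs d r.
Proof.
move=> qr; rewrite /bernstein_coefs; congr (xget _ _).
apply/seteqP; split=> c /=; apply: eq_bernstein_expansion => // t t01.
by rewrite qr.
Qed.

Lemma eq_has_bernstein {R : realType} (d : nat) (q r : R -> R) :
  {in `[0, 1], q =1 r} -> has_bernstein d q -> has_bernstein d r.
Proof. by move=> qr [c qc]; exists c; exact: eq_bernstein_expansion qc. Qed.

(** Existence of both expansions matters for the forward direction: a function without one gets the
    default coefficients 0, which do not determine it. *)
Lemma bernstein_coefs_eqP {R : realType} (d : nat) (q r : R -> R) :
  has_bernstein d q -> has_bernstein d r ->
  bernstein_coefs d q = bernstein_coefs d r <-> {in `[0, 1], q =1 r}.
Proof.
move=> [c qc] [c' rc]; split=> [|/eq_bernstein_coefs//].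
rewrite (bernstein_coefsE qc) (bernstein_coefsE rc) => cc' t t01.
by rewrite qc// rc// cc'.
Qed.

Lemma has_bernstein0 {R : realType} (d : nat) :
  has_bernstein d (fun _ : R => 0).
Proof. by exists 0 => t _; rewrite big1// => j _; rewrite mxE mul0r. Qed.

Lemma has_bernsteinD {R : realType} (d : nat) (q r : R -> R) :
  has_bernstein d q -> has_bernstein d r ->
  has_bernstein d (fun t => q t + r t).
Proof.
move=> [c qc] [c' rc]; exists (c + c') => t t01.
by rewrite qc// rc// -big_split; apply: eq_bigr => j _; rewrite mxE mulrDl.
Qed.

Lemma has_bernsteinZ {R : realType} (d : nat) (k : R) (q : R -> R) :
  has_bernstein d q -> has_bernstein d (fun t => k * q t).
Proof.
move=> [c qc]; exists (k *: c) => t t01.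
by rewrite qc// mulr_sumr; apply: eq_bigr => j _; rewrite mxE mulrA.
Qed.

Lemma has_bernstein_sum {R : realType} (d : nat) (I : Type) (s : seq I)
    (P : pred I) (q : I -> R -> R) :
  (forall i, P i -> has_bernstein d (q i)) ->
  has_bernstein d (fun t => \sum_(i <- s | P i) q i t).
Proof.
move=> hq; elim: s => [|i s IHs].
  apply: eq_has_bernstein (has_bernstein0 d) => t _.
  by rewrite big_nil.
have [Pi|Pi] := boolP (P i); last first.
  by apply: eq_has_bernstein IHs => t _; rewrite big_cons (negbTE Pi).
apply: eq_has_bernstein (has_bernsteinD _ _ _ (hq i Pi) IHs) => t _.
by rewrite big_cons Pi.
Qed.

Lemma has_bernstein_monomial {R : realType} (d j : nat) :
  (j <= d)%N -> has_bernstein d (fun t : R => t ^+ j * (1 - t) ^+ (d - j)).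
Proof.
rewrite -ltnS => jd; exists ('C(d, j)%:R^-1 *: delta_mx 0 (Ordinal jd)) => t _.
rewrite (bigD1 (Ordinal jd))//= big1 => [|k kj].
  rewrite !mxE !eqxx mulr1 addr0 /bernstein /= !mulrA mulVf ?mul1r//.
  by rewrite pnatr_eq0 -lt0n bin_gt0 -ltnS.
by rewrite !mxE (negbTE kj) andbF mulr0 mul0r.
Qed.

(** Writing k + t l = (k + l) t + k (1 - t) sends each product of powers of t and 1 - t of total
    degree d to a combination of two such products of degree d + 1. *)
Lemma has_bernstein_mul_affine {R : realType} (d : nat) (k l : R)
    (q : R -> R) :
  has_bernstein d q -> has_bernstein d.+1 (fun t => (k + t * l) * q t).
Proof.
move=> [c qc].
suff : has_bernstein d.+1 (fun t => \sum_(j < d.+1) (c 0 j * 'C(d, j)%:R) *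
    ((k + l) * (t ^+ j.+1 * (1 - t) ^+ (d.+1 - j.+1)) +
     k * (t ^+ j * (1 - t) ^+ (d.+1 - j)))).
  apply: eq_has_bernstein => t t01; rewrite qc// mulr_sumr.
  apply: eq_bigr => j _.
  rewrite /bernstein subSS subSn ?exprS; last by rewrite -ltnS.
  by move: (t ^+ j) (_ ^+ (d - j)) => x y; ring.
apply: has_bernstein_sum => j _; apply/has_bernsteinZ/has_bernsteinD.
  by apply/has_bernsteinZ/has_bernstein_monomial.
by apply/has_bernsteinZ/has_bernstein_monomial/ltnW.
Qed.

Lemma has_bernstein_le {R : realType} (d e : nat) (q : R -> R) :
  (d <= e)%N -> has_bernstein d q -> has_bernstein e q.
Proof.
move=> /subnKC <-; elim: (e - d)%N => [|k IHk] hq; first by rewrite addn0.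
rewrite addnS.
(* Degree elevation: multiply by the constant 1, viewed as an affine factor. *)
apply: eq_has_bernstein (has_bernstein_mul_affine _ 1 0 _ (IHk hq)).
by move=> t _; rewrite mulr0 addr0 mul1r.
Qed.

Lemma has_bernstein_mul_affineX {R : realType} (d n : nat) (k l : R)
    (q : R -> R) :
  has_bernstein d q -> has_bernstein (n + d) (fun t => (k + t * l) ^+ n * q t).
Proof.
move=> hq; elim: n => [|n IHn].
  by apply: eq_has_bernstein hq => t _; rewrite expr0 mul1r.
apply: eq_has_bernstein (has_bernstein_mul_affine _ k l _ IHn) => t _.
by rewrite exprS mulrA.
Qed.

(** * Restriction of fields to affine edges *)

(** On a line each coordinate is affine in t, so a monomial becomes a product of powers of affine
    factors whose exponents add up to its total degree. *)
Lemma poly_field_has_bernstein {R : realType} (d : nat)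
    (vh : 'rV[R]_2 -> 'rV[R]_2) (a b : 'rV[R]_2) (i : 'I_2) :
  poly_field d vh -> (forall t, t \in `[0, 1] -> ref_triangle (a + t *: b)) ->
  has_bernstein d (fun t => vh (a + t *: b) 0 i).
Proof.
move=> /(_ i)[p [/all_filterP pd vhp]] Tab.
(* Keeping the degree bound as a filter on the sum makes it available for each monomial
   separately. *)
suff : has_bernstein d (fun t =>
    \sum_(m <- mpoly.msupp p | (mpoly.mdeg m <= d)%N)
    mpoly.mcoeff m p * \prod_(j < 2) (a 0 j + t * b 0 j) ^+
      mpoly.fun_of_multinom m j).
  apply: eq_has_bernstein => t t01.
  rewrite vhp; last exact: Tab.
  rewrite mpoly.mevalE -big_filter pd; apply: eq_bigr => m _.
  by congr (_ * _); apply: eq_bigr => j _; rewrite !mxE.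
apply: has_bernstein_sum => m md; apply: has_bernsteinZ.
apply: has_bernstein_le md _.
have h1 : has_bernstein 0 (fun _ : R => 1).
  apply: eq_has_bernstein (has_bernstein_monomial 0 0 _) => // t _.
  by rewrite !expr0 mulr1.
pose n := mpoly.fun_of_multinom m.
(* Starting from the constant 1 in degree 0, the degree reached is [n 0 + (n 1 + 0)], the expanded
   total degree of [m]. *)
have := has_bernstein_mul_affineX _ (n 0) (a 0 0) (b 0 0) _
  (has_bernstein_mul_affineX _ (n 1) (a 0 1) (b 0 1) _ h1).
rewrite mpoly.mdegE !big_ord_recl big_ord0 /=.
have -> : lift ord0 ord0 = 1 :> 'I_2 by apply/val_inj.
apply: eq_has_bernstein => t _.
rewrite !big_ord_recl big_ord0 /=.
have -> : lift ord0 ord0 = 1 :> 'I_2 by apply/val_inj.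
by [].
Qed.

Lemma is_derive_affine {R : realType} {V : normedModType R} (a b : V) (t : R) :
  is_derive t 1 (fun s : R => a + s *: b) b.
Proof.
have dZ : differentiable ( *:%R ^~ b : R -> V) t by exact: ex_diff.
have /derivableP ? : derivable ( *:%R ^~ b : R -> V) t 1.
  exact/derivable1_diffP.
have -> : (fun s : R => a + s *: b) = cst a + ( *:%R ^~ b) by [].
by apply: is_derive_eq; rewrite add0r deriveE// diff_val scale1r.
Qed.

(** The velocity of an affine parameterization is a constant [b], so the trace is a fixed linear
    combination of the components of [vh] and the degree does not grow. *)
Lemma tangential_has_bernstein {R : realType} (d : nat)
    (vh : 'rV[R]_2 -> 'rV[R]_2) (i : 'I_3) (c : R -> 'rV[R]_2) :
  poly_field d vh -> affine_edge_param (@ref_edge R i) c ->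
  has_bernstein d (tangential vh c).
Proof.
move=> pvh [[a [b cE]] cbij].
have Tab t : t \in `[0, 1] -> ref_triangle (a + t *: b).
  by move=> t01; rewrite -cE; have [/(_ t)[]] := cbij.
have -> : c = (fun t => a + t *: b) by apply/funext.
suff : has_bernstein d (fun t => \sum_(j < 2) b 0 j * vh (a + t *: b) 0 j).
  apply: eq_has_bernstein => t t01; rewrite /tangential /dot mxE derive1E.
  rewrite (@derive_val _ _ _ _ _ _ _ (is_derive_affine a b t)).
  by apply: eq_bigr => j _; rewrite mxE mulrC.
apply: has_bernstein_sum => j _; apply: has_bernsteinZ.
exact: poly_field_has_bernstein.
Qed.

Lemma tangential_affine_edge {R : realType} (F : 'rV[R]_2 -> 'rV[R]_3)
    (v : 'rV[R]_3 -> 'rV[R]_3) (vh : 'rV[R]_2 -> 'rV[R]_2) (i : 'I_3)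
    (c : R -> 'rV[R]_2) (g : R -> 'rV[R]_3) :
  regular_map F -> covariant_piola F vh v ->
  affine_edge_param (@ref_edge R i) c ->
  {in `[0, 1], F \o c =1 g} ->
  (forall t, t \in `[0, 1] -> derivable g t 1) ->
  {in `[0, 1], tangential v g =1 tangential vh c}.
Proof.
move=> rF pF [[a [b cE]] cbij] Fg dg t t01.
have Tc : ref_triangle (c t) by have [/(_ t)[]] := cbij.
have dc : derivable c t 1.
  have -> : c = (fun t => a + t *: b) by apply/funext.
  by have [] := is_derive_affine a b t.
rewrite -(tangential_piola F v vh)// /tangential -Fg//; congr dot.
(* [g] is tied to [F \o c] only on [0, 1], so the velocities at 0 and 1 are compared through
   one-sided limits. *)
apply/esym/(eq_derive1_itv _ _ _ 0 1) => //; last exact: dg.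
apply/derivable1_diffP/differentiable_comp; first exact/derivable1_diffP.
exact: regular_map_differentiable.
Qed.

Theorem theorem7p1 (R : realType) (S : set 'rV[R]_3)
    (nu : 'rV[R]_3 -> 'rV[R]_3) (hS : oriented_surface S nu) :
  (forall (F : 'rV[R]_2 -> 'rV[R]_3) (v : 'rV[R]_3 -> 'rV[R]_3)
      (vh : 'rV[R]_2 -> 'rV[R]_2) (i : 'I_3) (gh : R -> 'rV[R]_2),
    curved_triangle_on S F ->
    tangent_field S (F @` (@ref_triangle R)) v ->
    covariant_piola F vh v ->
    edge_param (@ref_edge R i) gh ->
    forall t : R, t \in `[0, 1] ->
      tangential v (F \o gh) t = tangential vh gh t)
  /\
  (forall (F1 F2 : 'rV[R]_2 -> 'rV[R]_3) (v1 v2 : 'rV[R]_3 -> 'rV[R]_3)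
      (vh1 vh2 : 'rV[R]_2 -> 'rV[R]_2) (d : nat) (i1 i2 : 'I_3)
      (gh1 gh2 : R -> 'rV[R]_2) (e : set 'rV[R]_3) (g : R -> 'rV[R]_3),
    curved_triangle_on S F1 -> curved_triangle_on S F2 ->
    tangent_field S (F1 @` (@ref_triangle R)) v1 ->
    tangent_field S (F2 @` (@ref_triangle R)) v2 ->
    covariant_piola F1 vh1 v1 -> covariant_piola F2 vh2 v2 ->
    poly_field d vh1 -> poly_field d vh2 ->
    F1 @` (@ref_edge R i1) = e -> F2 @` (@ref_edge R i2) = e ->
    affine_edge_param (@ref_edge R i1) gh1 ->
    affine_edge_param (@ref_edge R i2) gh2 ->
    (forall t : R, t \in `[0, 1] ->
      [/\ F1 (gh1 t) = g t, F2 (gh2 t) = g t & derivable g t 1]) ->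
    [/\ bernstein_coefs d (tangential v1 g)
          = bernstein_coefs d (tangential vh1 gh1),
        bernstein_coefs d (tangential v2 g)
          = bernstein_coefs d (tangential vh2 gh2) &
        bernstein_coefs d (tangential vh1 gh1)
          = bernstein_coefs d (tangential vh2 gh2) <->
        (forall t : R, t \in `[0, 1] -> tangential v1 g t = tangential v2 g t)]).
Proof.
split=> [F v vh i gh [rF _] _ pF [dgh ghbij] t t01|].
  apply: tangential_piola => //; last exact: dgh.
  by have [/(_ t)[]] := ghbij.
move=> F1 F2 v1 v2 vh1 vh2 d i1 i2 gh1 gh2 e g [rF1 _] [rF2 _] _ _ pF1 pF2.
move=> pvh1 pvh2 _ _ agh1 agh2 Fg.
have dg t : t \in `[0, 1] -> derivable g t 1 by move=> /Fg[].
have v1E : {in `[0, 1], tangential v1 g =1 tangential vh1 gh1}.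
  apply: (tangential_affine_edge F1 v1 vh1 i1 gh1 g rF1 pF1 agh1 _ dg).
  by move=> t /Fg[].
have v2E : {in `[0, 1], tangential v2 g =1 tangential vh2 gh2}.
  apply: (tangential_affine_edge F2 v2 vh2 i2 gh2 g rF2 pF2 agh2 _ dg).
  by move=> t /Fg[].
split; [exact: eq_bernstein_coefs|exact: eq_bernstein_coefs|].
have hb1 := tangential_has_bernstein d vh1 i1 gh1 pvh1 agh1.
have hb2 := tangential_has_bernstein d vh2 i2 gh2 pvh2 agh2.
(* Equal coefficients amount to equal reference traces; [v1E] and [v2E] carry this over to the
   common curve [g]. *)
have iffE := bernstein_coefs_eqP d _ _ hb1 hb2.
split=> [/iffE h t t01|h].
  by rewrite (v1E _ t01) (v2E _ t01) (h _ t01).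
by apply/iffE => t t01; rewrite -(v1E _ t01) -(v2E _ t01) (h _ t01).
Qed.
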